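(* Let $G$ be any graph on $n$ vertices with maximum degree $\Delta$. Then $$HG(G) \leq 1+\frac{\Delta}{2}+ \frac{\sqrt{(\Delta +2)^2 + 2(n^2-3n-n\Delta)}}{2}.$$
   Context: Graphs are finite and simple, with at least one vertex. Let $G$ be a graph on $n$ vertices and let $k\ge 1$ be an integer. A $k$-coloring of $G$ is an arbitrary (not necessarily proper) map $c:V(G)\to\{1,\ldots,k\}$ (hat colors). A guessing strategy $\mathcal{S}$ with $k$ colors is a deterministic rule assigning to each vertex $v$ a function that takes the colors $(c(w))_{w\in N(v)}$ of the neighbors of $v$ (not including $v$ itself) and outputs a guess in $\{1,\ldots,k\}$. Vertex $v$ guesses correctly in $c$ if its guess equals $c(v)$. The strategy is winning if for every $k$-coloring $c$ at least one vertex guesses correctly. The hat guessing number $HG(G)$ is the largest $k$ for which a winning guessing strategy with $k$ colors exists. *)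

(* Defs.v *)
From mathcomp Require Import all_boot.

Set Implicit Arguments.
Unset Strict Implicit.
Unset Printing Implicit Defensive.

Record graph := Graph {
  vertex :> finType;
  adj : rel vertex;
  adj_sym : symmetric adj;
  adj_irr : irreflexive adj;
  vertex_gt0 : 0 < #|vertex|
}.

Definition degree (G : graph) (v : G) : nat := #|[set w | adj v w]|.

Definition max_degree (G : graph) : nat := \max_(v : G) degree v.

(* The colors are 0, ..., k-1 instead of 1, ..., k. *)
Definition coloring (G : graph) (k : nat) := {ffun G -> 'I_k}.

Definition neighbor_coloring (G : graph) (k : nat) (v : G) :=
  {ffun {w : G | adj v w} -> 'I_k}.

(* Finite functions are used so that "there is a winning strategy" is a
   boolean, to which ex_maxn applies. *)
Definition strategy (G : graph) (k : nat) :=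
  {dffun forall v : G, {ffun neighbor_coloring k v -> 'I_k}}.

Definition view (G : graph) (k : nat) (c : coloring G k) (v : G) :
  neighbor_coloring k v := [ffun w => c (val w)].

Definition guesses_correctly (G : graph) (k : nat) (S : strategy G k)
  (c : coloring G k) (v : G) : bool := S v (view c v) == c v.

Definition winning (G : graph) (k : nat) (S : strategy G k) : bool :=
  [forall c : coloring G k, [exists v : G, guesses_correctly S c v]].

Definition winnable (G : graph) (k : nat) : bool :=
  (0 < k) && [exists S : strategy G k, winning S].

Fact winnable_ex (G : graph) : exists k, winnable G k.
Proof.
exists 1; apply/andP; split=> //; apply/existsP.
exists (finfun (fun v : G => [ffun=> ord0])).
apply/forallP=> c; case/card_gt0P: (vertex_gt0 G) => v _.
by apply/existsP; exists v; rewrite /guesses_correctly [_ (view _ _)]ord1 [c v]ord1.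
Qed.

(* For each vertex v, exactly one color of v out of k makes its guess correct,
   so v is correct in at most k ^ #|G| / k colorings. *)
Fact winnable_le (G : graph) (k : nat) : winnable G k -> k <= #|G|.
Proof.
case/andP=> k_gt0 /existsP[S /forallP winS].
pose A v := [set c : coloring G k | guesses_correctly S c v].
pose upd v (p : 'I_k * coloring G k) : coloring G k :=
  [ffun w => if w == v then p.1 else p.2 w].
have leA v : k * #|A v| <= #|{: coloring G k}|.
  rewrite -[k in k * _]card_ord -cardsT -cardsX.
  rewrite -(card_in_imset (f := upd v)); first exact: max_card.
  move=> [a c] [b d]; rewrite !inE /= => /eqP cv /eqP dv /ffunP E.
  have eq_ab : a = b by have := E v; rewrite !ffunE eqxx.
  have eqN w : w != v -> c w = d w.
    by move=> /negbTE ne; have := E w; rewrite !ffunE ne.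
  congr (_, _) => //; apply/ffunP=> w; have [->|/eqN//] := eqVneq w v.
  rewrite -cv -dv; congr (S v _); apply/ffunP=> -[u vu]; rewrite !ffunE /=.
  by apply: eqN; apply: contraTneq vu => ->; rewrite adj_irr.
have cov : #|{: coloring G k}| <= \sum_(v : G) #|A v|.
  under eq_bigr do rewrite -sum1_card big_mkcond /=.
  rewrite exchange_big /= -sum1_card leq_sum // => c _.
  have /existsP[v cv] := winS c.
  by rewrite (bigD1 v) //= inE cv.
have C_gt0 : 0 < #|{: coloring G k}| by rewrite card_ffun card_ord expn_gt0 k_gt0.
rewrite -(leq_pmul2r C_gt0) (leq_trans (leq_mul (leqnn k) cov)) //.
by rewrite big_distrr /= -sum_nat_const leq_sum.
Qed.

Definition hat_guessing_number (G : graph) : nat :=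
  ex_maxn (winnable_ex G) (@winnable_le G).

(* Main.v *)
(* Let X(c) be the number of vertices guessing correctly in c, for a winning
   strategy with k colors, and let m = n - 1 - Delta.  Every vertex is correct in
   a 1/k fraction of the colorings, so X - 1 >= 0 has mean y = (n - k)/k, and
   X = 1 has probability at least 1 - y.  If v is the only correct vertex in c and
   w is one of its at least m non-neighbors, recolor w with its own guess: then v
   and w are both correct, and v is the only correct non-neighbor of w.  The
   number of such pairs (v, w) in a coloring is at most X <= 2 (X - 1), and each
   arises from at most k - 1 colors of w; hence m (1 - y) <= 2 (k - 1) y,
   which rearranges to 2 k (k - 2 - Delta) <= n (n - 3 - Delta). *)
Require Import Defs.
From mathcomp Require Import all_boot all_order all_algebra.
From mathcomp Require Import zify lra.
Import Order.TTheory GRing.Theory Num.Theory.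
Local Open Scope ring_scope.

Section Recolor.
Local Open Scope nat_scope.
Variables (G : graph) (k : nat) (S : strategy G k).
Implicit Types (c d : coloring G k) (u v w : G).

Definition recolor c v (a : 'I_k) : coloring G k :=
  [ffun w => if w == v then a else c w].

Definition guess c v : 'I_k := S v (view c v).

Lemma recolor_self c v a : recolor c v a v = a.
Proof. by rewrite ffunE eqxx. Qed.

Lemma recolor_other c v a w : w != v -> recolor c v a w = c w.
Proof. by rewrite ffunE => /negbTE->. Qed.

Lemma recolorK c v a : recolor (recolor c v a) v (c v) = c.
Proof. by apply/ffunP=> w; rewrite !ffunE; case: eqP => // ->. Qed.

Lemma guess_recolor c v a w : ~~ adj w v -> guess (recolor c v a) w = guess c w.
Proof.
move=> wv; congr (S w _); apply/ffunP=> -[u wu]; rewrite !ffunE /=.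
by case: eqP => // uv; rewrite -uv wu in wv.
Qed.

Lemma guess_recolor_self c v a : guess (recolor c v a) v = guess c v.
Proof. by rewrite guess_recolor // adj_irr. Qed.

Lemma correct_recolor c v a w : w != v -> ~~ adj w v ->
  guesses_correctly S (recolor c v a) w = guesses_correctly S c w.
Proof.
by move=> wv nwv; rewrite /guesses_correctly -/(guess _ _) guess_recolor //
  recolor_other.
Qed.

Lemma correct_recolor_guess c v :
  guesses_correctly S (recolor c v (guess c v)) v.
Proof.
by rewrite /guesses_correctly -/(guess _ _) guess_recolor_self recolor_self.
Qed.

Definition correct_set c : {set G} := [set v | guesses_correctly S c v].

Lemma uniquely_correctE c v u :
  correct_set c = [set v] -> guesses_correctly S c u = (u == v).
Proof. by move=> cv; rewrite -in_set1 -cv inE. Qed.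

(** No vertex sees its own color, so after [v] is recolored its guess still gives back the color it
    had when it was correct. *)
Lemma card_correct_colorings v :
  k * #|[set c | guesses_correctly S c v]| <= #|{: coloring G k}|.
Proof.
rewrite -[k in k * _]card_ord -cardsT -cardsX.
rewrite -(card_in_imset (f := fun p => recolor p.2 v p.1)); first exact: max_card.
apply: (can_in_inj (g := fun d => (d v, recolor d v (guess d v)))).
move=> [a c]; rewrite !inE /= => /eqP cv.
by rewrite recolor_self guess_recolor_self /guess cv recolorK.
Qed.

Definition nonadjacent v w := (v != w) && ~~ adj v w.

(** Neighbors of [w] are left unconstrained, since recoloring [w] may change their guesses. *)
Definition only_correct_nonneighbor c v w :=
  [&& nonadjacent v w, guesses_correctly S c v, guesses_correctly S c w &
      [forall u, nonadjacent u w ==> guesses_correctly S c u ==> (u == v)]].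

Lemma card_uniquely_correct v w : nonadjacent v w ->
  #|[set c | correct_set c == [set v]]|
    <= k.-1 * #|[set c | only_correct_nonneighbor c v w]|.
Proof.
move=> vw; set U := [set c | _ == _]; set B := [set c | _ v w].
have /andP[v_neq_w nadj_vw] := vw.
(* Recoloring w with its guess sends U to B and fixes B, so adjoining B to U
   turns the factor k of the injection below into k - 1. *)
suff: #|U :|: B| <= k * #|B|.
  have dUB : U :&: B = set0.
    apply/setP=> c; rewrite !inE.
    apply/negP=> /andP[/eqP cv /and4P[_ _]].
    by rewrite (uniquely_correctE _ _ _ cv) eq_sym (negbTE v_neq_w).
  by rewrite cardsU dUB cards0; nia.
rewrite -[k in k * _]card_ord -cardsT -cardsX.
(* The old color of [w] is kept in the pair, so that the recoloring can be undone. *)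
pose f c := (c w, recolor c w (guess c w)).
have f_inj : injective f.
  by apply: (can_inj (g := fun p => recolor p.2 w p.1)) => c; rewrite /= recolorK.
rewrite -(card_imset _ f_inj); apply/subset_leq_card/subsetP=> _ /imsetP[c cUB ->].
rewrite !inE /=.
have eq_correct u : nonadjacent u w ->
    guesses_correctly S (recolor c w (guess c w)) u = guesses_correctly S c u.
  by case/andP=> uw nuw; rewrite correct_recolor.
move: cUB; rewrite !inE => cUB.
apply/and4P; split=> //.
- rewrite eq_correct //; case/orP: cUB => [/eqP cv|/and4P[]//].
  by rewrite (uniquely_correctE _ _ _ cv).
- exact: correct_recolor_guess.
apply/forallP=> u; apply/implyP=> uw; rewrite eq_correct //.
case/orP: cUB => [/eqP cv|/and4P[_ _ _ /forallP/(_ u)]]; last by rewrite uw.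
by rewrite (uniquely_correctE _ _ _ cv) implybb.
Qed.

(** The vertex [w] determines [v], so the pairs inject into the correct set. A single pair makes
    both [v] and [w] correct, so then X >= 2 and X <= 2 (X - 1). *)
Lemma card_only_correct_nonneighbor c :
  #|[set p | only_correct_nonneighbor c p.1 p.2]| <= 2 * #|correct_set c|.-1.
Proof.
set P := [set p | _].
have [->|[[v w] vw_in]] := set_0Vmem P; first by rewrite cards0.
have leP : #|P| <= #|correct_set c|.
  have inj2 : {in P &, injective (fun p : G * G => p.2)}.
    move=> [v1 w1] [v2 w2]; rewrite !inE /= => /and4P[vw1 cv1 _ _].
    move=> /and4P[_ _ _ /forallP/(_ v1)] H E; subst w2.
    by move: H; rewrite vw1 cv1 /= => /eqP->.
  rewrite -(card_in_imset inj2); apply/subset_leq_card/subsetP=> u.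
  by case/imsetP=> p + ->; rewrite !inE => /and4P[].
have ge2 : 1 < #|correct_set c|.
  move: vw_in; rewrite inE /= => /and4P[/andP[v_neq_w _] cv cw _].
  by apply/card_gt1P; exists v, w; rewrite !inE.
by lia.
Qed.

Lemma degree_lt_card v : degree v < #|G|.
Proof.
rewrite -cardsT; apply: proper_card; apply/properP; split; first exact: subsetT.
by exists v; rewrite !inE // adj_irr.
Qed.

Lemma max_degree_lt_card : max_degree G < #|G|.
Proof.
rewrite -(prednK (vertex_gt0 G)) ltnS; apply/bigmax_leqP => v _.
by rewrite -ltnS (prednK (vertex_gt0 G)) degree_lt_card.
Qed.

Lemma card_nonadjacent v : #|G|.-1 - max_degree G <= #|[set w | nonadjacent v w]|.
Proof.
have le_deg : degree v <= max_degree G by exact: leq_bigmax.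
have -> : [set w | nonadjacent v w] = ~: (v |: [set w | adj v w]).
  by apply/setP=> w; rewrite !inE /nonadjacent negb_or eq_sym.
rewrite [leqRHS]cardsCs setCK cardsU1 inE adj_irr /= -/(degree v).
by lia.
Qed.

(** This is m (1 - y) <= 2 (k - 1) y with y = (n - k)/k and denominators cleared. *)
Lemma winning_bound : 0 < k -> winning S ->
  (#|G|.-1 - max_degree G) * k
    <= (2 * k.-1 + (#|G|.-1 - max_degree G)) * (#|G| - k).
Proof.
move=> k_gt0 /forallP winS; set m := _ - max_degree G.
have X_gt0 c : 0 < #|correct_set c|.
  by have /existsP[v cv] := winS c; apply/card_gt0P; exists v; rewrite inE.
set K := #|{: coloring G k}|.
have K_gt0 : 0 < K by rewrite /K card_ffun card_ord expn_gt0 k_gt0.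
(* [T] is [K] times the mean of X - 1, [a] counts the colorings with X = 1, and [b] the triples (c,
   v, w). *)
pose T := \sum_c #|correct_set c|.-1.
pose a := \sum_v #|[set c | correct_set c == [set v]]|.
pose b := \sum_(p : G * G) #|[set c | only_correct_nonneighbor c p.1 p.2]|.
have sumX : \sum_c #|correct_set c| = K + T.
  rewrite /K -sum1_card -big_split.
  by apply: eq_bigr => c _; rewrite /= add1n prednK.
have leX : k * (K + T) <= #|G| * K.
  have -> : K + T = \sum_v #|[set c | guesses_correctly S c v]|.
    rewrite -sumX; under eq_bigr do rewrite -sum1_card big_mkcond.
    rewrite exchange_big /=; apply: eq_bigr => v _.
    by rewrite -big_mkcond -sum1_card; apply: eq_bigl => c; rewrite !inE.
  rewrite big_distrr -sum_nat_const leq_sum //= => v _.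
  exact: card_correct_colorings.
(* A coloring either has X = 1, and is counted in [a], or contributes at least 1 to [T]. *)
have geK : K <= a + T.
  rewrite /a; under eq_bigr do rewrite -sum1_card big_mkcond.
  rewrite exchange_big /K -sum1_card -big_split leq_sum //= => c _.
  have [/eqP/cards1P[v cv]|X_neq1] := eqVneq #|correct_set c| 1.
    by rewrite (bigD1 v) //= in_set cv eqxx.
  by have := X_gt0 c; lia.
have leb : b <= 2 * T.
  rewrite /b; under eq_bigr do rewrite -sum1_card big_mkcond.
  rewrite exchange_big big_distrr leq_sum //= => c _.
  apply: leq_trans (card_only_correct_nonneighbor c).
  rewrite -big_mkcond -sum1_card leq_eqVlt; apply/orP; left; apply/eqP.
  by apply: eq_bigl => p; rewrite !inE.
have lea : m * a <= k.-1 * b.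
  rewrite /a /b -(pair_bigA _ (fun v w =>
    #|[set c | only_correct_nonneighbor c v w]|)) !big_distrr leq_sum //= => v _.
  apply: leq_trans (leq_mul (card_nonadjacent v) (leqnn _)) _.
  rewrite -sum_nat_const big_distrr /= big_mkcond leq_sum //= => w _.
  by rewrite inE; case: ifP => // /card_uniquely_correct.
have le_T : k * T <= (#|G| - k) * K by nia.
have le_mK : m * K <= (2 * k.-1 + m) * T by nia.
(* [T] is eliminated between [le_T] and [le_mK], and the common factor [K] cancels. *)
rewrite -(leq_pmul2r K_gt0).
have := leq_mul (leqnn k) le_mK.
have := leq_mul (leqnn (2 * k.-1 + m)) le_T.
by nia.
Qed.

End Recolor.

Theorem theorem1p1 (R : rcfType) (G : graph) :
  let n : R := #|G|%:R in
  let Delta : R := (max_degree G)%:R in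
  (hat_guessing_number G)%:R <=
    1 + Delta / 2
      + Num.sqrt ((Delta + 2) ^+ 2 + 2 * (n ^+ 2 - 3 * n - n * Delta)) / 2.
Proof.
set n : R := #|G|%:R; set Delta : R := (max_degree G)%:R => /=.
rewrite /hat_guessing_number; case: ex_maxnP => k winG _.
have le_kn := winnable_le winG.
have /andP[k_gt0 /existsP[S winS]] := winG.
have := winning_bound _ _ _ k_gt0 winS.
have lt_Dn := max_degree_lt_card G.
(* The truncated subtractions are exact, because Delta < n and 0 < k <= n. *)
rewrite -(ler_nat R) !(natrM, natrD) !natrB //; last by lia.
rewrite -!subn1 !natrB ?vertex_gt0 // -/n -/Delta => bound.
set D : R := _ ^+ 2 + _.
(* Completing the square in k: the difference of the two sides is twice that of [bound]. *)
have leD : (2 * k%:R - 2 - Delta) ^+ 2 <= D by rewrite /D; nra.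
have := ler_wsqrtr leD; rewrite sqrtr_sqr => /(le_trans (ler_norm _)).
by lra.
Qed.
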